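(* Let $W(s)=\frac{(s^2-1)^2}{4}$ and let $$k_1:=\inf_{L>0}\ \inf\Big\{R_{-L}^L(u)\colon u\in W^{2,2}(-L,L),\ u'(\pm L)=0,\ u'\neq0\Big\},$$ where $u'\neq 0$ means that $u'$ is not identically zero. Then $$\frac18\le k_1\le 0.6846 .$$
   Context: For $a<b$ and $u\in W^{2,2}(a,b)$, the Rayleigh quotient is $$R_a^b(u):=\frac{\int_a^b(W(u)+(u'')^2)\,dx}{\int_a^b(u')^2\,dx}\ \text{ if } \int_a^b(u')^2\,dx>0,\qquad R_a^b(u):=+\infty\ \text{ otherwise.}$$ Functions in $W^{2,2}$ of an interval are identified with their $C^1$ representatives (up to the closed interval). *)

(* Defs.v *)
From HB Require Import structures.
From mathcomp Require Import all_boot all_order all_algebra.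
From mathcomp Require Import all_classical all_reals all_analysis.

Set Implicit Arguments.
Unset Strict Implicit.
Unset Printing Implicit Defensive.

Import Order.TTheory GRing.Theory Num.Theory.
Import numFieldNormedType.Exports.

Local Open Scope classical_set_scope.
Local Open Scope ring_scope.

Section Definitions.
Context {R : realType}.
Local Notation mu := (@lebesgue_measure R).
Implicit Types (a b L : R) (f g phi u : R -> R).

Definition double_well (s : R) : R := (s ^+ 2 - 1) ^+ 2 / 4.

Definition test_function a b phi : Prop :=
  (forall (n : nat) (x : R), derivable (derive1n n phi) x 1) /\
  (exists c d : R, [/\ a < c, d < b & forall x, x \notin `[c, d] -> phi x = 0]).

Definition square_integrable a b f : Prop :=
  measurable_fun `]a, b[ f /\
  mu.-integrable `]a, b[ (fun x => (f x ^+ 2)%:E).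

Definition weak_derivative a b f g : Prop :=
  forall phi, test_function a b phi ->
    \int[mu]_(x in `]a, b[) (f x * derive1 phi x) =
    - \int[mu]_(x in `]a, b[) (g x * phi x).

Definition C1_closed a b u u1 : Prop :=
  [/\ {within `[a, b], continuous u},
      {within `[a, b], continuous u1} &
      forall x, x \in `]a, b[ -> is_derive x 1 u (u1 x)].

(* u is (the C^1 representative of) an element of W^{2,2}(a, b), with
   derivatives u1 and u2.  Here u1 is the classical derivative of u, extended
   by continuity to [a, b], so that its values at a and b are meaningful; u2 is
   any representative of the weak second derivative. *)
Definition sobolev22 a b u u1 u2 : Prop :=
  [/\ C1_closed a b u u1,
      [/\ square_integrable a b u, square_integrable a b u1 &
          square_integrable a b u2],
      weak_derivative a b u u1 &
      weak_derivative a b u1 u2].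

(* The quotient takes the derivatives u1 = u' and u2 = u'' as arguments; it only
   depends on their almost everywhere classes, hence only on u when
   sobolev22 a b u u1 u2 holds, in which case all integrands are integrable. *)
Definition rayleigh a b u u1 u2 : \bar R :=
  if 0 < \int[mu]_(x in `]a, b[) (u1 x ^+ 2) then
    (\int[mu]_(x in `]a, b[) (double_well (u x) + u2 x ^+ 2)
     / \int[mu]_(x in `]a, b[) (u1 x ^+ 2))%:E
  else +oo%E.

Definition admissible L u u1 u2 : Prop :=
  [/\ sobolev22 (- L) L u u1 u2, u1 (- L) = 0, u1 L = 0 &
      exists2 x, x \in `[(- L), L] & u1 x != 0].

Definition k1_on L : \bar R :=
  ereal_inf [set r | exists u u1 u2,
    admissible L u u1 u2 /\ r = rayleigh (- L) L u u1 u2].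

End Definitions.

Definition k1 (R : realType) : \bar R :=
  ereal_inf [set k1_on L | L in [set L : R | 0 < L]].

(* Main.v *)
Require Import Defs.
From mathcomp Require Import all_boot all_order all_algebra.
From mathcomp Require Import all_classical all_reals all_analysis.
From mathcomp Require Import measurable_realfun ring lra.

Set Implicit Arguments.
Unset Strict Implicit.
Unset Printing Implicit Defensive.

Import Order.TTheory GRing.Theory Num.Theory.
Import numFieldNormedType.Exports.

Local Open Scope classical_set_scope.
Local Open Scope ring_scope.

(** The upper bound is obtained from the trial function u(x) = (5/4) sin(3x/5)
    on the interval of half-length 5 pi / 6, at whose ends u' vanishes; its
    quotient is about 0.674.

    The lower bound is a calibration argument.  Suppose that G(u, p) satisfies
    G(u, 0) = 0 and, for all real u, p and q,

      W(u) + q^2 - p^2 / 8 + G_u(u, p) p + G_p(u, p) q >= 0.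

    With p = u' and q = u'', the last two terms are the derivative of
    x |-> G(u(x), u'(x)), whose integral over (-L, L) vanishes because u' does
    at both ends; integrating the inequality gives
    int (W(u) + u''^2) >= (1/8) int u'^2.  Such a G is the function [calib],

      G(u, p) = u p (u^2 + p^2 - 1) / (u^2 + p^2 + 1).

    Minimising over q turns the inequality into
    W - p^2/8 + G_u p - G_p^2/4 >= 0, which after clearing denominators is a
    polynomial inequality in s = u^2 and r = p^2 ([calib_poly_ge0],
    [calib_ineq]).

    Two points need care as u'' is only a weak derivative.  First, u' is shown
    to be the integral of u'' ([weak_derivative_ftc]) by testing with the
    difference of two steep smooth ramps; the ramps are built from exp(-1/t),
    and their smoothness follows from membership in a class of functions
    closed under differentiation.  Second, the chain rule for G(u, u') is
    replaced by a comparison on short intervals [s, t]: by the mean value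
    theorem along the segment joining (u, u')(s) to (u, u')(t), the increment
    of G is G_u . (u(t) - u(s)) + G_p . (u'(t) - u'(s)) at some point of the
    segment, where the slope of u' is the mean q of u'' over [s, t], and the
    integral of u''^2 is at least (t - s) q^2 ([energy_local]).  The error is
    an arbitrarily small multiple of t - s, and such local estimates add up
    ([le_of_local_growth]). *)

(** * Integration on bounded intervals *)

Section Integrals.
Context {R : realType}.
Local Notation mu := (@lebesgue_measure R).
Implicit Types (F f g : R -> R) (a b s t x : R).

Lemma is_derive_continuous F f : (forall t, is_derive t 1 F (f t)) ->
  continuous F.
Proof.
by move=> dF t; have [/derivable1_diffP/differentiable_continuous] := dF t.
Qed.

Lemma within_continuous_integrable f a b (i : interval R) :
  {within `[a, b], continuous f} -> [set` i] `<=` `[a, b] ->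
  mu.-integrable [set` i] (EFin \o f).
Proof.
move=> cf ab; apply: (@integrableS _ _ _ mu `[a, b]) => //.
by apply: continuous_compact_integrable => //; exact: segment_compact.
Qed.

Lemma Rintegral_oo_derive F f a b : a < b -> (forall t, is_derive t 1 F (f t)) ->
  continuous f -> \int[mu]_(t in `]a, b[) f t = F b - F a.
Proof.
move=> ab dF cf.
have cF := is_derive_continuous dF.
have cw : {within `[a, b], continuous f} by exact: continuous_subspaceT.
rewrite Rintegral_itv_bndo_bndc; last first.
  exact: (within_continuous_integrable cw (@subset_itv_oo_cc _ _ _ _)).
rewrite Rintegral_itv_obnd_cbnd; last first.
  by apply: (within_continuous_integrable cw); exact: subset_itv_oc_cc.
rewrite /Rintegral (@continuous_FTC2 _ f F)//.
- split => [t _||]; first by have [] := dF t.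
  + exact/cvg_at_right_filter/cF.
  + exact/cvg_at_left_filter/cF.
- by move=> t _; rewrite derive1E; exact: derive_val.
Qed.

Lemma Rintegral_split (i j : itv_bound R) x f :
  mu.-integrable [set` Interval i j] (EFin \o f) ->
  (i <= BRight x)%O -> (BRight x <= j)%O ->
  \int[mu]_(t in [set` Interval i j]) f t =
  \int[mu]_(t in [set` Interval i (BRight x)]) f t +
  \int[mu]_(t in [set` Interval (BRight x) j]) f t.
Proof. by move=> fi ix xj; rewrite -(Rintegral_itvB fi ix xj); ring. Qed.

Lemma integrable_dominated (D : set (measurableTypeR R)) f g : measurable D ->
  measurable_fun D f -> mu.-integrable D (EFin \o g) ->
  (forall t, D t -> `|f t| <= g t) -> mu.-integrable D (EFin \o f).
Proof.
move=> mD mf ig fg; apply: le_integrable ig => //.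
  exact/measurable_EFinP.
by move=> t Dt; rewrite /= lee_fin (le_trans (fg _ Dt))// ler_norm.
Qed.

Lemma integrable_cst_itv (i : interval R) a b (c : R) :
  [set` i] `<=` `[a, b] -> mu.-integrable [set` i] (EFin \o (fun _ : R => c)).
Proof.
by apply: within_continuous_integrable; apply: continuous_subspaceT => ?; exact: cvg_cst.
Qed.

Lemma integrable_add (D : set (measurableTypeR R)) f g : measurable D ->
  mu.-integrable D (EFin \o f) -> mu.-integrable D (EFin \o g) ->
  mu.-integrable D (EFin \o (fun t => f t + g t)).
Proof. by move=> mD fi gi; exact: (integrableD mD fi gi). Qed.

Lemma integrable_scale (D : set (measurableTypeR R)) (c : R) f : measurable D ->
  mu.-integrable D (EFin \o f) -> mu.-integrable D (EFin \o (fun t => c * f t)).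
Proof. by move=> mD fi; exact: (integrableZl mD c fi). Qed.

Lemma integrable_sub (i j : interval R) f : [set` i] `<=` [set` j] ->
  mu.-integrable [set` j] (EFin \o f) -> mu.-integrable [set` i] (EFin \o f).
Proof. by move=> ij; apply: integrableS. Qed.

Lemma integrable_norm (D : set (measurableTypeR R)) f : measurable D ->
  mu.-integrable D (EFin \o f) -> mu.-integrable D (EFin \o (fun t => `|f t|)).
Proof. by move=> mD fi; apply: (eq_integrable mD _ _ _ (integrable_abse fi)). Qed.

Lemma square_integrable_integrable a b f : square_integrable a b f ->
  mu.-integrable `]a, b[ (EFin \o f).
Proof.
move=> [mf if2]; apply: (@integrable_dominated _ _ (fun t => 1 + f t ^+ 2)) => //.
  apply: integrable_add => //.
  exact: (@integrable_cst_itv _ a b 1 (@subset_itv_oo_cc _ _ _ _)).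
by move=> t _; have := sqr_ge0 (`|f t| - 1); rewrite -(real_normK (num_real (f t))); nra.
Qed.

Lemma Rintegral_cst_itv (m : R) s t : s < t ->
  \int[mu]_(r in `]s, t]) (fun _ : R => m) r = m * (t - s).
Proof.
move=> st; have := lebesgue_measure_itv (Interval (BRight s) (BRight t)).
by rewrite /= lte_fin st /Rintegral integral_cst//= => ->.
Qed.

End Integrals.

(** * Smooth ramps *)

Section SmoothStep.
Context {R : realType}.
Implicit Types (f g : R -> R) (s t x : R) (k : nat).

(** The family t^-k exp(-1/t), extended by 0; it is closed under
    differentiation up to linear combinations (see [is_derive_flat]). *)
Definition flat k t : R := if 0 < t then t^-1 ^+ k * expR (- t^-1) else 0.

Lemma flat_ge0 k t : 0 <= flat k t.
Proof.
rewrite /flat; case: ifPn => // t0.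
by rewrite mulr_ge0 ?expR_ge0 ?exprn_ge0 ?invr_ge0 ?ltW.
Qed.

Lemma flat_gt0 k t : 0 < t -> 0 < flat k t.
Proof. by move=> t0; rewrite /flat t0 mulr_gt0 ?expR_gt0 ?exprn_gt0 ?invr_gt0. Qed.

Lemma flat_eq0 k t : t <= 0 -> flat k t = 0.
Proof. by move=> t0; rewrite /flat ltNge t0. Qed.

(** Makes the difference quotient of [flat k] at 0 equal to [flat k.+1],
    whose continuity there gives the derivative. *)
Lemma flat_factor k t : flat k t = flat k.+1 t * t.
Proof.
rewrite /flat; case: ifPn => t0; last by rewrite mul0r.
by rewrite exprS; field; rewrite gt_eqF.
Qed.

(** exp x >= x^(k+1) / (k+1)! at x = 1/t. *)
Lemma flat_le k t : flat k.+1 t <= k.+1`!%:R.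
Proof.
rewrite /flat; case: ifPn => // t0.
have ti0 : 0 <= t^-1 by rewrite invr_ge0 ltW.
have := expR_ge1Dxn k ti0; rewrite expRN.
set F := _%:R; have F0 : 0 < F by rewrite ltr0n fact_gt0.
set P := _ ^+ _ => h.
rewrite ler_pdivrMr ?expR_gt0//.
rewrite mulrC -ler_pdivrMr//; lra.
Qed.

Lemma flat_continuous0 k : {for 0, continuous (flat k)}.
Proof.
rewrite /prop_for /continuous_at flat_eq0//.
apply/cvgr0Pnorm_le => e e0.
have F0 : 0 < k.+1`!%:R :> R by rewrite ltr0n fact_gt0.
near=> t.
rewrite flat_factor normrM ger0_norm ?flat_ge0//.
apply: (@le_trans _ _ (k.+1`!%:R * `|t|)).
  by rewrite ler_wpM2r// flat_le.
rewrite mulrC -ler_pdivlMr//.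
near: t; apply: (@cvgr0_norm_le _ _ _ _ _ id); first exact: cvg_id.
by rewrite divr_gt0.
Unshelve. all: by end_near. Qed.

Lemma is_derive_flat k t :
  is_derive t 1 (flat k) (flat k.+2 t - k%:R * flat k.+1 t).
Proof.
have [t0|t0|->] := ltgtP t 0.
- rewrite !flat_eq0 ?(ltW t0)// mulr0 subr0.
  apply: (@near_eq_is_derive _ _ _ (cst 0)).
  near=> s; rewrite flat_eq0//.
  by apply: ltW; near: s; exact: lt_nbhsl.
- have tn0 : t != 0 by rewrite gt_eqF.
  apply: (@near_eq_is_derive _ _ _
      ((fun s : R => s^-1) ^+ k * (expR \o (- (fun s : R => s^-1))))).
    near=> s; rewrite /flat !fctE ifT//.
    by near: s; exact: lt_nbhsr.
  have dV : is_derive t 1 (fun s : R => s^-1) (- t ^- 2).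
    apply: is_derive_eq; first exact: is_deriveV.
    by rewrite /GRing.scale/= mulr1.
  have dX := @is_deriveX _ _ (fun s : R => s^-1) k t 1 _ dV.
  have dE := @is_derive1_comp _ expR (- (fun s : R => s^-1)) t _ _
    (is_derive_expR _) (@is_deriveN _ _ _ _ _ _ _ dV).
  apply: is_derive_eq.
  rewrite /flat t0 /GRing.scale/= !fctE.
  case: k {dX} => [|k].
    by rewrite !expr0 /= ; field.
  rewrite -pred_Sn !exprS; set E := expR _; by field.
- rewrite !flat_eq0// mulr0 subr0.
  apply/is_derive1_caratheodory; exists (flat k.+1); split.
  + by move=> z; rewrite (flat_eq0 k (lexx 0)) !subr0 flat_factor.
  + exact: flat_continuous0.
  + exact: flat_eq0.
Unshelve. all: by end_near. Qed.

(** Each generator is derivable with a derivative in the class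
    ([stably_derivable_is_derive]), so derivability at every order needs no
    formula for higher derivatives. *)
Inductive stably_derivable : (R -> R) -> Prop :=
| SD_cst (c : R) : stably_derivable (cst c)
| SD_flat k (a b : R) : stably_derivable (fun t => flat k (a * t + b))
| SD_add f g : stably_derivable f -> stably_derivable g ->
    stably_derivable (f + g)
| SD_mul f g : stably_derivable f -> stably_derivable g ->
    stably_derivable (f * g)
| SD_inv f : (forall t, f t != 0) -> stably_derivable f ->
    stably_derivable (fun t => (f t)^-1).

Lemma stably_derivable_is_derive f : stably_derivable f ->
  exists2 g, stably_derivable g & forall t, is_derive t 1 f (g t).
Proof.
elim=> {f} [c|k a b|f g _ [f' sf' df] _ [g' sg' dg]|f g sf [f' sf' df] sg [g' sg' dg]|f f0 sf [f' sf' df]].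
- by exists (cst 0) => [|t]; [exact: SD_cst|exact: is_derive_cst].
- exists (cst a * ((fun t => flat k.+2 (a * t + b)) +
    cst (- k%:R) * (fun t => flat k.+1 (a * t + b)))).
    do ![apply: SD_mul|apply: SD_add|exact: SD_cst|exact: SD_flat].
  move=> t.
  have da : is_derive t 1 (fun t : R => a * t + b) a.
    apply: is_derive_eq; rewrite /GRing.scale /=; ring.
  have := @is_derive1_comp _ (flat k) _ t _ _ (is_derive_flat k _) da.
  move=> h; apply: is_derive_eq.
  by rewrite /= !fctE /=; ring.
- by exists (f' + g'); [exact: SD_add|move=> t; exact: is_deriveD].
- exists (f * g' + g * f').
    by apply: SD_add; exact: SD_mul.
  by move=> t; exact: is_deriveM.
- exists (cst (-1) * ((fun t => (f t)^-1) * (fun t => (f t)^-1)) * f').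
    do ![apply: SD_mul|exact: SD_cst|exact: SD_inv|done].
  move=> t; have h := is_deriveV (f0 t) (df t); apply: is_derive_eq.
  by rewrite /GRing.scale/= !fctE /=; field.
Qed.

Lemma derive1E_is_derive f g : (forall t, is_derive t 1 f (g t)) -> derive1 f = g.
Proof. by move=> df; apply/funext => t; rewrite derive1E; exact: derive_val. Qed.

Lemma stably_derivable_derive1n f k : stably_derivable f ->
  stably_derivable (derive1n k f).
Proof.
elim: k f => [//|k IH] f sf; rewrite derive1Sn; apply: IH.
by have [g sg dg] := stably_derivable_is_derive sf; rewrite (derive1E_is_derive dg).
Qed.

Lemma stably_derivable_smooth f k x : stably_derivable f ->
  derivable (derive1n k f) x 1.
Proof.
move=> /(stably_derivable_derive1n k)/stably_derivable_is_derive[g _ dg].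
by have [] := dg x.
Qed.

End SmoothStep.

Section Ramp.
Context {R : realType}.
Implicit Types (s t x e a b : R).

(** A smooth transition from 0 to 1 across [x, x + e]. *)
Definition ramp x e t : R :=
  flat 0 ((t - x) / e) / (flat 0 ((t - x) / e) + flat 0 (1 - (t - x) / e)).

Definition ramp' x e t : R :=
  e^-1 * (flat 2 ((t - x) / e) * flat 0 (1 - (t - x) / e) +
          flat 0 ((t - x) / e) * flat 2 (1 - (t - x) / e)) /
  (flat 0 ((t - x) / e) + flat 0 (1 - (t - x) / e)) ^+ 2.

Lemma ramp_den_gt0 s : 0 < flat 0 s + flat 0 (1 - s) :> R.
Proof.
have [s0|s0] := leP s 0.
  by rewrite ltr_wpDl ?flat_ge0// flat_gt0// subr_gt0 (le_lt_trans s0).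
by rewrite ltr_wpDr ?flat_ge0// flat_gt0.
Qed.

Lemma stably_derivable_ramp x e : stably_derivable (ramp x e).
Proof.
have -> : ramp x e = (fun t => flat 0 (e^-1 * t + - x / e)) *
  (fun t => (((fun t => flat 0 (e^-1 * t + - x / e)) +
    (fun t => flat 0 (- e^-1 * t + (1 + x / e)))) t)^-1).
  apply/funext => t; rewrite /ramp !fctE.
  have -> : (t - x) / e = e^-1 * t + - x / e by ring.
  by have -> : 1 - (e^-1 * t + - x / e) = - e^-1 * t + (1 + x / e) by ring.
apply: SD_mul; first exact: SD_flat.
apply: SD_inv; last by apply: SD_add; exact: SD_flat.
move=> t; rewrite !fctE.
have -> : - e^-1 * t + (1 + x / e) = 1 - (e^-1 * t + - x / e) by ring.
by rewrite gt_eqF// ramp_den_gt0.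
Qed.

Lemma is_derive_ramp x e t : is_derive t 1 (ramp x e) (ramp' x e t).
Proof.
have dl : is_derive t 1 (fun t : R => (t - x) / e) e^-1.
  apply: is_derive_eq; rewrite /GRing.scale /=; ring.
have dl' : is_derive t 1 (fun t : R => 1 - (t - x) / e) (- e^-1).
  apply: is_derive_eq; rewrite /GRing.scale /=; ring.
have d0 := @is_derive1_comp _ (flat 0) _ t _ _ (is_derive_flat _ _) dl.
have d1 := @is_derive1_comp _ (flat 0) _ t _ _ (is_derive_flat _ _) dl'.
have dD := is_deriveD d0 d1.
have D0 := ramp_den_gt0 ((t - x) / e).
have nz : ((flat 0 \o (fun t : R => (t - x) / e)) +
  (flat 0 \o (fun t : R => 1 - (t - x) / e))) t != 0 by exact: lt0r_neq0.
have dV := is_deriveV nz dD.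
apply: is_derive_eq.
rewrite /ramp' /GRing.scale /= !fctE /=.
move: D0; move: (e^-1) (flat 0 _) (flat 2 _) (flat 1 _) (flat 0 _) (flat 2 _) (flat 1 _).
move=> i A C C' B D D' AB; field; exact: lt0r_neq0.
Qed.

Lemma continuous_ramp' x e : continuous (ramp' x e).
Proof.
have := stably_derivable_derive1n 1 (stably_derivable_ramp x e).
rewrite derive1n1 (derive1E_is_derive (is_derive_ramp x e)).
by case/stably_derivable_is_derive => g _; exact: is_derive_continuous.
Qed.

Lemma ramp'_ge0 x e t : 0 < e -> 0 <= ramp' x e t.
Proof.
move=> e0; rewrite /ramp' mulr_ge0 ?invr_ge0 ?exprn_ge0 ?(ltW (ramp_den_gt0 _))//.
by rewrite mulr_ge0 ?addr_ge0 ?mulr_ge0 ?flat_ge0 ?invr_ge0 ?ltW.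
Qed.

Lemma ramp_le0 x e t : 0 < e -> t <= x -> ramp x e t = 0.
Proof.
move=> e0 tx; have s0 : (t - x) / e <= 0 by rewrite ler_pdivrMr// mul0r subr_le0.
by rewrite /ramp (flat_eq0 _ s0) mul0r.
Qed.

Lemma ramp_ge1 x e t : 0 < e -> x + e <= t -> ramp x e t = 1.
Proof.
move=> e0 tx; have s1 : 1 <= (t - x) / e by rewrite ler_pdivlMr//; lra.
rewrite /ramp [X in _ / (_ + X)]flat_eq0; last by rewrite subr_le0.
by rewrite addr0 divff// gt_eqF// flat_gt0// (lt_le_trans ltr01).
Qed.

Lemma ramp_itv x e t : 0 <= ramp x e t <= 1.
Proof.
have D0 := ramp_den_gt0 ((t - x) / e).
rewrite /ramp; apply/andP; split; first by rewrite divr_ge0 ?flat_ge0 ?ltW.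
by rewrite ler_pdivrMr// mul1r lerDl flat_ge0.
Qed.

Lemma ramp'_eq0 x e t : 0 < e -> t \notin `[x, x + e] -> ramp' x e t = 0.
Proof.
move=> e0; rewrite in_itv/= negb_and -!ltNge => /orP[tx|tx]; rewrite /ramp'.
  have s0 : (t - x) / e <= 0 by rewrite ler_pdivrMr// mul0r subr_le0 ltW.
  by rewrite !(@flat_eq0 _ _ ((t - x) / e))// !mul0r addr0 mulr0 mul0r.
have s1 : 1 <= (t - x) / e by rewrite ler_pdivlMr//; lra.
by rewrite !(@flat_eq0 _ _ (1 - (t - x) / e)) ?subr_le0// !mulr0 addr0 mulr0 mul0r.
Qed.

(** A smooth version of the indicator function of ]x, y]. *)
Lemma test_function_ramp a b x y e : a < x -> x <= y -> 0 < e -> y + e < b ->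
  test_function a b (ramp x e - ramp y e).
Proof.
move=> ax xy e0 yb; split.
  move=> n t; apply: stably_derivable_smooth.
  have -> : ramp x e - ramp y e = ramp x e + cst (-1) * ramp y e.
    by apply/funext => s; rewrite !fctE mulN1r.
  apply: SD_add; first exact: stably_derivable_ramp.
  by apply: SD_mul; [exact: SD_cst|exact: stably_derivable_ramp].
exists x, (y + e); split => // t.
rewrite in_itv/= negb_and -!ltNge !fctE => /orP[tx|ty].
  by rewrite !ramp_le0 ?subrr//; lra.
by rewrite !ramp_ge1 ?subrr//; lra.
Qed.

Lemma derive1_test_ramp x y e :
  derive1 (ramp x e - ramp y e) = ramp' x e - ramp' y e.
Proof.
by apply: derive1E_is_derive => t; apply: is_deriveB; exact: is_derive_ramp.
Qed.

End Ramp.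

(** * The fundamental theorem for weak derivatives *)

Section DuBoisReymond.
Context {R : realType}.
Local Notation mu := (@lebesgue_measure R).
Implicit Types (s t x e d a b : R) (f g u : R -> R).

Lemma measurable_ramp (D : set (measurableTypeR R)) x e : measurable D -> measurable_fun D (ramp x e).
Proof.
move=> mD; apply: measurable_funTS; apply: continuous_measurable_fun.
exact: is_derive_continuous (is_derive_ramp x e).
Qed.

Lemma integrable_mul_ramp (D : set (measurableTypeR R)) f x e : measurable D ->
  mu.-integrable D (EFin \o f) ->
  mu.-integrable D (EFin \o (fun t => f t * ramp x e t)).
Proof.
move=> mD fi.
have mf : measurable_fun D f by apply/measurable_EFinP; exact: measurable_int fi.
apply: (@integrable_dominated _ _ _ (fun t => `|f t|)) => //.
- by apply: measurable_funM => //; exact: measurable_ramp.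
- exact: (integrable_norm _ fi).
- move=> t _; rewrite normrM ler_piMr//.
  by have /andP[r0 r1] := ramp_itv x e t; rewrite ger0_norm.
Qed.

(** [ramp' x e] is nonnegative, has integral 1 and is supported in
    [x, x + e]: it is an approximate identity at x. *)
Lemma cvg_Rintegral_ramp' a b x f d : a < x < b ->
  {within `[a, b], continuous f} -> 0 < d ->
  \forall e \near 0^'+,
    `|\int[mu]_(t in `]a, b[) (f t * ramp' x e t) - f x| <= d.
Proof.
move=> /andP[ax xb] cf d0.
have ab := lt_trans ax xb.
have cx : {for x, continuous f}.
  by move/(continuous_within_itvP _ ab): cf => [+ _ _]; apply; rewrite in_itv/= ax xb.
have [r /= r0 fr] : \forall t \near x, `|f x - f t| <= d.
  by move/cvgrPdist_le: cx; apply.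
near=> e.
have e0 : 0 < e by [].
have xe : x + e < b.
  by rewrite -ltrBrDl; near: e; apply: nbhs_right_lt; rewrite subr_gt0.
have er : e < r by near: e; exact: nbhs_right_lt.
have cc (c : R) : mu.-integrable `]a, b[ (EFin \o (fun t => c * ramp' x e t)).
  apply: (@within_continuous_integrable _ _ a b); last exact: subset_itv_oo_cc.
  apply: continuous_subspaceT => t; apply: cvgM; first exact: cvg_cst.
  exact: continuous_ramp'.
have I1 : \int[mu]_(t in `]a, b[) ramp' x e t = 1.
  rewrite (Rintegral_oo_derive ab (is_derive_ramp x e) (@continuous_ramp' _ _ _)).
  by rewrite ramp_ge1 ?(ltW xe)// ramp_le0 ?(ltW ax)// subr0.
have ir : mu.-integrable `]a, b[ (EFin \o ramp' x e).
  by apply: (eq_integrable _ _ _ _ (cc 1)) => // t _; rewrite /= mul1r.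
have fi : mu.-integrable `]a, b[ (EFin \o (fun t => f t * ramp' x e t)).
  apply: (@within_continuous_integrable _ _ a b); last exact: subset_itv_oo_cc.
  move=> t; apply: cvgM; first exact: cf.
  by apply: continuous_subspaceT; exact: continuous_ramp'.
have key t : `|f t - f x| * ramp' x e t <= d * ramp' x e t.
  have [xt|xt] := boolP (t \in `[x, x + e]); last by rewrite ramp'_eq0// !mulr0.
  rewrite ler_wpM2r ?ramp'_ge0// distrC fr//=.
  by move: xt; rewrite in_itv/= => /andP[? ?]; rewrite ler0_norm; lra.
have IZ c : \int[mu]_(t in `]a, b[) (c * ramp' x e t) = c.
  by rewrite RintegralZl// I1 mulr1.
rewrite ler_distl; apply/andP; split.
  rewrite -[leLHS]IZ; apply: le_Rintegral => // t _.
  have := key t; have := ramp'_ge0 x t e0; have := ler_norm (f x - f t).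
  by rewrite distrC; nra.
rewrite -[leRHS]IZ; apply: le_Rintegral => // t _.
by have := key t; have := ramp'_ge0 x t e0; have := ler_norm (f t - f x); nra.
Unshelve. all: by end_near. Qed.

(** The two integrals differ only through the part over ]x, x + e], where the
    ramp is between 0 and 1, and the integral of |f| there is small. *)
Lemma cvg_Rintegral_ramp a b x f d : a < x < b ->
  mu.-integrable `]a, b[ (EFin \o f) -> 0 < d ->
  \forall e \near 0^'+,
    `|\int[mu]_(t in `]a, b[) (f t * ramp x e t) - \int[mu]_(t in `]x, b[) f t| <= d.
Proof.
move=> /andP[ax xb] fi d0.
pose c := (x + b) / 2.
have xc : x < c by rewrite /c; lra.
have cb : c < b by rewrite /c; lra.
have xcab : `[x, c] `<=` `]a, b[ by apply: subset_itv; rewrite bnd_simp.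
have fic : mu.-integrable `[x, c] (EFin \o (fun t => `|f t|)).
  by apply: (integrable_sub xcab) => //; exact: (integrable_norm _ fi).
have near_small := parameterized_integral_near_left xc d0 fic.
have [r /= r0 small] := near_small.
near=> e.
have e0 : 0 < e by [].
have xe : x + e < c.
  by rewrite -ltrBrDl; near: e; apply: nbhs_right_lt; rewrite subr_gt0.
have er : e < r by near: e; exact: nbhs_right_lt.
set h := fun t => f t * ramp x e t.
have hi : mu.-integrable `]a, b[ (EFin \o h) by exact: integrable_mul_ramp.
have fi_xb : mu.-integrable `]x, b[ (EFin \o f).
  by apply: integrableS fi => //; apply: subset_itvr; rewrite bnd_simp ltW.
have hix : mu.-integrable `]x, b[ (EFin \o h).
  by apply: integrableS hi => //; apply: subset_itvr; rewrite bnd_simp ltW.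
have sub : `]x, x + e] `<=` `]x, b[.
  by apply: subset_itvl; rewrite bnd_simp; lra.
rewrite (Rintegral_split (x := x) hi) ?bnd_simp//; [|exact: ltW].
have -> : \int[mu]_(t in `]a, x]) h t = 0.
  transitivity (\int[mu]_(t in `]a, x]) (fun _ : R => 0 : R) t).
    by apply: eq_Rintegral => t; rewrite inE/= in_itv/= => /andP[_ tx];
       rewrite /h ramp_le0// mulr0.
  by rewrite Rintegral_cst// mul0r.
rewrite add0r (@Rintegral_split _ _ _ (x + e) h)// ?bnd_simp; try lra.
rewrite (@Rintegral_split _ _ _ (x + e) f)// ?bnd_simp; try lra.
have -> : \int[mu]_(t in `]x + e, b[) h t = \int[mu]_(t in `]x + e, b[) f t.
  by apply: eq_Rintegral => t; rewrite inE/= in_itv/= => /andP[xt _];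
       rewrite /h ramp_ge1 ?(ltW xt)// mulr1.
rewrite (_ : forall p q r : R, p + q - (r + q) = p - r); last by move=> *; ring.
have fie := integrable_sub sub fi_xb; have hie := integrable_sub sub hix.
rewrite -RintegralB//.
have hfe : mu.-integrable `]x, x + e] (EFin \o (fun t => h t - f t)).
  have nfe := integrable_scale (-1) (measurable_itv _) fie.
  apply: (eq_integrable _ _ _ _ (integrable_add (measurable_itv _) hie nfe)) => //.
  by move=> t _; rewrite /= mulN1r.
apply: le_trans; first by apply: le_normr_Rintegral => //; exact: hfe.
have sub' : `]x, x + e] `<=` `[x, c].
  by apply: subset_itv; rewrite bnd_simp//; lra.
have fae := integrable_sub sub' fic.
apply: (@le_trans _ _ (\int[mu]_(t in `]x, x + e]) `|f t|)).
  apply: le_Rintegral => //; first exact: (integrable_norm _ hfe).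
  move=> t _; rewrite /h -[X in _ - X]mulr1 -mulrBr normrM ler_piMr//.
  by have /andP[? ?] := ramp_itv x e t; rewrite ler0_norm; lra.
rewrite Rintegral_itv_obnd_cbnd; last exact: fae.
apply: ltW; apply: le_lt_trans (small (x + e) _ _); last by lra.
  exact: ler_norm.
by rewrite /ball_/= opprD addrA subrr sub0r normrN gtr0_norm.
Unshelve. all: by end_near. Qed.

(** Testing with a ramp at x minus a ramp at y, the left side of the weak
    formulation tends to u x - u y and the right side to minus the integral
    of g over ]x, y]. *)
Lemma weak_derivative_ftc a b u g x y : a < x -> x < y -> y < b ->
  {within `[a, b], continuous u} -> mu.-integrable `]a, b[ (EFin \o g) ->
  weak_derivative a b u g ->
  u y - u x = \int[mu]_(t in `]x, y]) g t.
Proof.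
move=> ax xy yb cu gi wd.
have xb := lt_trans xy yb; have ay := lt_trans ax xy.
have gx : mu.-integrable `]x, b[ (EFin \o g).
  by apply: integrableS gi => //; apply: subset_itvr; rewrite bnd_simp ltW.
have -> : \int[mu]_(t in `]x, y]) g t =
    \int[mu]_(t in `]x, b[) g t - \int[mu]_(t in `]y, b[) g t.
  by rewrite (@Rintegral_split _ (BRight x) (BLeft b) y g) ?bnd_simp ?(ltW xy)// addrK.
apply/eqP; rewrite -subr_eq0 -normr_le0; apply/ler_addgt0Pl => d d0; rewrite addr0.
have d4 : 0 < d / 4 by lra.
near (0 : R)^'+ => e.
have e0 : 0 < e by [].
have ye : y + e < b.
  by rewrite -ltrBrDl; near: e; apply: nbhs_right_lt; rewrite subr_gt0.
have Hx : `|\int[mu]_(t in `]a, b[) (u t * ramp' x e t) - u x| <= d / 4.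
  by near: e; apply: cvg_Rintegral_ramp' => //; rewrite ax.
have Hy : `|\int[mu]_(t in `]a, b[) (u t * ramp' y e t) - u y| <= d / 4.
  by near: e; apply: cvg_Rintegral_ramp' => //; rewrite ay.
have Gx : `|\int[mu]_(t in `]a, b[) (g t * ramp x e t) - \int[mu]_(t in `]x, b[) g t| <= d / 4.
  by near: e; apply: cvg_Rintegral_ramp => //; rewrite ax.
have Gy : `|\int[mu]_(t in `]a, b[) (g t * ramp y e t) - \int[mu]_(t in `]y, b[) g t| <= d / 4.
  by near: e; apply: cvg_Rintegral_ramp => //; rewrite ay.
have iu z : mu.-integrable `]a, b[ (EFin \o (fun t => u t * ramp' z e t)).
  apply: (@within_continuous_integrable _ _ a b); last exact: subset_itv_oo_cc.
  move=> t; apply: cvgM; first exact: cu.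
  by apply: continuous_subspaceT; exact: continuous_ramp'.
have ig z : mu.-integrable `]a, b[ (EFin \o (fun t => g t * ramp z e t)).
  exact: integrable_mul_ramp.
have := wd _ (test_function_ramp ax (ltW xy) e0 ye).
rewrite derive1_test_ramp.
under eq_Rintegral do rewrite !fctE mulrBr.
rewrite RintegralB//.
under [X in _ = - X]eq_Rintegral do rewrite !fctE mulrBr.
rewrite RintegralB//.
move: Hx Hy Gx Gy; rewrite !ler_distl.
move: (\int[mu]_(t in `]x, b[) _) (\int[mu]_(t in `]y, b[) _) => A B.
move: (\int[mu]_(t in `]a, b[) (u t * ramp' x e t)).
move: (\int[mu]_(t in `]a, b[) (u t * ramp' y e t)).
move: (\int[mu]_(t in `]a, b[) (g t * ramp x e t)).
move: (\int[mu]_(t in `]a, b[) (g t * ramp y e t)).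
move: (u x) (u y) => ? ? ? ? ? ?.
move=> /andP[? ?] /andP[? ?] /andP[? ?] /andP[? ?] ?.
by apply/andP; split; lra.
Unshelve. all: by end_near. Qed.


End DuBoisReymond.

(** * A calibration *)

Section Calibration.
Context {R : realType}.
Implicit Types (t u p v s r a e d : R).

Definition calib u p : R := u * p * (u ^+ 2 + p ^+ 2 - 1) / (1 + u ^+ 2 + p ^+ 2).

(** The partial derivatives of [calib] (see [calib_increment]). *)
Definition calib_u u p : R :=
  p * ((1 + u ^+ 2 + p ^+ 2) ^+ 2 - 2 * (1 + u ^+ 2 + p ^+ 2) + 4 * u ^+ 2) /
  (1 + u ^+ 2 + p ^+ 2) ^+ 2.

Definition calib_p u p : R :=
  u * ((1 + u ^+ 2 + p ^+ 2) ^+ 2 - 2 * (1 + u ^+ 2 + p ^+ 2) + 4 * p ^+ 2) /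
  (1 + u ^+ 2 + p ^+ 2) ^+ 2.

Lemma calib_den_ge1 u p : 1 <= 1 + u ^+ 2 + p ^+ 2.
Proof. by have := sqr_ge0 u; have := sqr_ge0 p; lra. Qed.

(** With s = u^2 and r = p^2 this is 4 (1 + s + r)^4 times
    W - p^2/8 + G_u p - G_p^2/4.  Its part free of r is a nonnegative multiple
    of (1 - s)^2, and its only monomials with a negative coefficient and a
    power of r are - r/2 and - 4 r^2.  For s >= 1/3 these are absorbed by
    18 s r and 12 s r^2; for s < 1/3 they are part of (1 - 3 s) q, where
    q >= 0 depends only on r. *)
Lemma calib_poly_ge0 s r : 0 <= s -> 0 <= r ->
  0 <= ((1 - s) ^+ 2 - r / 2) * (1 + s + r) ^+ 4
    + 4 * r * (1 + s + r) ^+ 2 * ((1 + s + r) ^+ 2 - 2 * (1 + s + r) + 4 * s)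
    - s * ((1 + s + r) ^+ 2 - 2 * (1 + s + r) + 4 * r) ^+ 2.
Proof.
move=> s0 r0.
(* The value at s = 0, without the term 7/2 r^5. *)
pose q : R := 1 - r / 2 - 4 * r ^+ 2 + r ^+ 3 + 7 * r ^+ 4.
have q0 : 0 <= q.
  have -> : q = 7 * (r ^+ 2 - 2 / 7) ^+ 2 + (r + 1) * (r - 1 / 2) ^+ 2
    + r / 4 + 5 / 28 by rewrite /q; field.
  have := sqr_ge0 (r ^+ 2 - 2 / 7).
  have : 0 <= (r + 1) * (r - 1 / 2) ^+ 2.
    by apply: mulr_ge0; [lra|exact: sqr_ge0].
  lra.
have low : 0 <= (1 - s) ^+ 2 + 18 * s * r + 12 * s * r ^+ 2 - r / 2
    - 4 * r ^+ 2 + r ^+ 3 + 7 * r ^+ 4.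
  have [s3|s3] := leP (1 / 3) s.
    have r2 := sqr_ge0 r; have r3 : 0 <= r ^+ 3 by rewrite exprn_ge0.
    have r4 : 0 <= r ^+ 4 by rewrite exprn_ge0.
    have := sqr_ge0 (1 - s).
    have : 0 <= (s - 1 / 3) * r by rewrite mulr_ge0//; lra.
    have : 0 <= (s - 1 / 3) * r ^+ 2 by rewrite mulr_ge0//; lra.
    lra.
  have -> : (1 - s) ^+ 2 + 18 * s * r + 12 * s * r ^+ 2 - r / 2
    - 4 * r ^+ 2 + r ^+ 3 + 7 * r ^+ 4 =
    (1 - 3 * s) * q + s * (1 + s) + s * (33 / 2 * r + 3 * r ^+ 3 + 21 * r ^+ 4).
    by rewrite /q; field.
  have q1 : 0 <= (1 - 3 * s) * q by apply: mulr_ge0 => //; lra.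
  have s1 : 0 <= s * (1 + s) by apply: mulr_ge0 => //; lra.
  have r3 : 0 <= r ^+ 3 by rewrite exprn_ge0.
  have r4 : 0 <= r ^+ 4 by rewrite exprn_ge0.
  have s2 : 0 <= s * (33 / 2 * r + 3 * r ^+ 3 + 21 * r ^+ 4).
    by apply: mulr_ge0 => //; lra.
  lra.
set P := (X in 0 <= X).
have -> : P = (1 - s) ^+ 2 + 18 * s * r + 12 * s * r ^+ 2 - r / 2
    - 4 * r ^+ 2 + r ^+ 3 + 7 * r ^+ 4
  + ((1 - s) ^+ 2 * (3 * s + 4 * s ^+ 2 + 3 * s ^+ 3 + s ^+ 4)
  + (25 * s ^+ 2 + 6 * s ^+ 3 + 7 / 2 * s ^+ 4 + 4 * s ^+ 5) * r
  + (22 * s ^+ 2 + 8 * s ^+ 3 + 6 * s ^+ 4) * r ^+ 2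
  + (22 * s + 13 * s ^+ 2 + 4 * s ^+ 3) * r ^+ 3
  + (11 * s + s ^+ 2) * r ^+ 4 + 7 / 2 * r ^+ 5).
  by rewrite /P; field.
have sn k : 0 <= s ^+ k by exact: exprn_ge0.
have rn k : 0 <= r ^+ k by exact: exprn_ge0.
apply: addr_ge0 => //; move: ((1 - s) ^+ 2) (sqr_ge0 (1 - s)) => z z0.
do ![apply: addr_ge0|apply: mulr_ge0] => //; rewrite ?invr_ge0.
Qed.

(** Completing the square in a leaves the polynomial of
    [calib_poly_ge0] over a positive denominator. *)
Lemma calib_ineq u p a :
  0 <= double_well u + a ^+ 2 - p ^+ 2 / 8 + calib_u u p * p + calib_p u p * a.
Proof.
have D1 := calib_den_ge1 u p.
have Dn0 : 1 + u ^+ 2 + p ^+ 2 != 0 by rewrite gt_eqF// (lt_le_trans ltr01).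
have key := calib_poly_ge0 (sqr_ge0 u) (sqr_ge0 p).
have -> : double_well u + a ^+ 2 - p ^+ 2 / 8 + calib_u u p * p + calib_p u p * a =
  (a + calib_p u p / 2) ^+ 2 +
  (((1 - u ^+ 2) ^+ 2 - p ^+ 2 / 2) * (1 + u ^+ 2 + p ^+ 2) ^+ 4
    + 4 * p ^+ 2 * (1 + u ^+ 2 + p ^+ 2) ^+ 2 *
      ((1 + u ^+ 2 + p ^+ 2) ^+ 2 - 2 * (1 + u ^+ 2 + p ^+ 2) + 4 * u ^+ 2)
    - u ^+ 2 * ((1 + u ^+ 2 + p ^+ 2) ^+ 2 - 2 * (1 + u ^+ 2 + p ^+ 2) + 4 * p ^+ 2) ^+ 2)
  / (4 * (1 + u ^+ 2 + p ^+ 2) ^+ 4).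
  by rewrite /double_well /calib_u /calib_p; field.
apply: addr_ge0; first exact: sqr_ge0.
by apply: divr_ge0 key _; rewrite mulr_ge0// exprn_ge0// (le_trans ler01).
Qed.

Lemma normr_calib_u u p : `|calib_u u p| <= 7 * `|p|.
Proof.
have D1 := calib_den_ge1 u p; have u2 := sqr_ge0 u; have p2 := sqr_ge0 p.
rewrite /calib_u; move: (p ^+ 2) (u ^+ 2) D1 u2 p2 => r s D1 s0 r0.
have D0 : 0 < (1 + s + r) ^+ 2 by rewrite exprn_gt0// (lt_le_trans ltr01).
rewrite normrM normrV ?unitfE ?gt_eqF// (gtr0_norm D0) ler_pdivrMr// normrM.
rewrite [leRHS](_ : _ = `|p| * (7 * (1 + s + r) ^+ 2)); last by ring.
apply: ler_wpM2l => //.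
by rewrite ler_norml; apply/andP; split; nra.
Qed.

(** Mean value theorem along the segment from (u0, p0) to (u1, p1). *)
Lemma calib_increment u0 p0 u1 p1 : exists2 th, 0 <= th <= 1 &
  calib u1 p1 - calib u0 p0 =
  calib_u (u0 + th * (u1 - u0)) (p0 + th * (p1 - p0)) * (u1 - u0) +
  calib_p (u0 + th * (u1 - u0)) (p0 + th * (p1 - p0)) * (p1 - p0).
Proof.
pose U (t : R) := u0 + t * (u1 - u0); pose P (t : R) := p0 + t * (p1 - p0).
have dU t : is_derive t 1 U (u1 - u0).
  by rewrite /U; apply: is_derive_eq; rewrite /GRing.scale /=; ring.
have dP t : is_derive t 1 P (p1 - p0).
  by rewrite /P; apply: is_derive_eq; rewrite /GRing.scale /=; ring.
have dG t : is_derive t 1 (fun t => calib (U t) (P t))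
    (calib_u (U t) (P t) * (u1 - u0) + calib_p (U t) (P t) * (p1 - p0)).
  have nz : (cst 1 + U ^+ 2 + P ^+ 2) t != 0.
    rewrite !fctE gt_eqF//.
    exact: (lt_le_trans ltr01 (calib_den_ge1 (U t) (P t))).
  have dU2 := @is_deriveX _ _ U 2 t 1 _ (dU t).
  have dP2 := @is_deriveX _ _ P 2 t 1 _ (dP t).
  have dD : is_derive t 1 (cst 1 + U ^+ 2 + P ^+ 2)
     (2 * U t * (u1 - u0) + 2 * P t * (p1 - p0)).
    have h := is_deriveD (is_deriveD (is_derive_cst (1 : R) t 1) dU2) dP2.
    apply: (is_derive_eq h).
    by rewrite /GRing.scale /=; ring.
  have dV := is_deriveV nz dD.
  have dN : is_derive t 1 (U * P * (U ^+ 2 + P ^+ 2 - cst 1))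
     ((u1 - u0) * P t * (U t ^+ 2 + P t ^+ 2 - 1) +
      U t * (p1 - p0) * (U t ^+ 2 + P t ^+ 2 - 1) +
      U t * P t * (2 * U t * (u1 - u0) + 2 * P t * (p1 - p0))).
    have h := is_deriveM (is_deriveM (dU t) (dP t))
      (is_deriveB (is_deriveD dU2 dP2) (is_derive_cst (1 : R) t 1)).
    apply: (is_derive_eq h).
    by rewrite /GRing.scale /= !fctE; ring.
  have -> : (fun t => calib (U t) (P t)) =
     (U * P * (U ^+ 2 + P ^+ 2 - cst 1)) *
     (fun t => ((cst 1 + U ^+ 2 + P ^+ 2) t)^-1) by [].
  apply: is_derive_eq.
  rewrite /GRing.scale /= !fctE /calib_u /calib_p; rewrite !fctE in nz.
  move: (U t) (P t) nz => x y nz; field; exact: nz.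
have [|th] := @MVT_segment _ _ _ 0 1 ler01 (fun t _ => dG t).
  exact: continuous_subspaceT (is_derive_continuous dG).
rewrite in_itv/= subr0 mulr1 => th01 E; exists th => //.
by rewrite -E /U /P; congr (calib _ _ - calib _ _); ring.
Qed.

(** [calib_ineq] survives a small perturbation of its arguments, uniformly in
    a: the coefficient of a is evaluated at the perturbed point, so only
    terms without a are moved, and [calib_u] is bounded. *)
Lemma calib_near u p e : 0 < e -> exists2 d, 0 < d &
  forall u' p' v a, `|u' - u| <= d -> `|p' - p| <= d -> `|v - p| <= d ->
  - e <= double_well u + a ^+ 2 - p ^+ 2 / 8 + calib_u u' p' * v + calib_p u' p' * a.
Proof.
move=> e0.
have e3 : 0 < e / 3 by lra.
have cW : {for u, continuous (@double_well R)}.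
  apply: differentiable_continuous; apply/derivable1_diffP.
  by rewrite /double_well.
have cS : {for p, continuous (fun q : R => q ^+ 2)} by exact: exprn_continuous.
have [d1 /= d10 Wd] : \forall w \near u, `|double_well u - double_well w| <= e / 3.
  by move/cvgrPdist_le: cW; apply.
have [d2 /= d20 Sd] : \forall w \near p, `|p ^+ 2 - w ^+ 2| <= e / 3.
  by move/cvgrPdist_le: cS; apply.
(* 14 = 2 * 7: v and p' are within 2 d of each other and the bound on
   calib_u carries a factor 7. *)
pose M := 14 * (`|p| + 1).
have M0 : 0 < M by rewrite /M; have := normr_ge0 p; lra.
exists (Num.min (Num.min (d1 / 2) (d2 / 2)) (Num.min 1 (e / 3 / M))).
  by rewrite !lt_min ltr01 !divr_gt0.
move=> u' p' v a; rewrite !le_min.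
move=> /andP[/andP[ud1 _] _] /andP[/andP[_ pd2] /andP[p1 pM]] /andP[_ /andP[_ vM]].
have := calib_ineq u' p' a.
have := Wd u'; rewrite /ball_/= distrC => /(_ ltac:(lra)).
have := Sd p'; rewrite /ball_/= distrC => /(_ ltac:(lra)).
rewrite !ler_distl => /andP[? ?] /andP[? ?] ?.
have Gb : `|calib_u u' p' * (v - p')| <= e / 3.
  rewrite normrM; have pM1 : `|p'| <= `|p| + 1.
    by rewrite -(subrK p p') addrC (le_trans (ler_normD _ _))// lerD2l.
  have vp : `|v - p'| <= 2 * (e / 3 / M).
    have -> : v - p' = (v - p) - (p' - p) by ring.
    by rewrite (le_trans (ler_normB _ _))//; lra.
  apply: (@le_trans _ _ (7 * (`|p| + 1) * (2 * (e / 3 / M)))).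
    apply: ler_pM => //; apply: le_trans (normr_calib_u _ _) _.
    by rewrite ler_wpM2l.
  by rewrite le_eqVlt; apply/orP; left; apply/eqP; rewrite /M; field; rewrite gt_eqF//; have := normr_ge0 p; lra.
move: Gb; rewrite ler_norml mulrBr => /andP[? ?].
lra.
Qed.

Lemma double_well_ge0 (r : R) : 0 <= double_well r.
Proof. by rewrite /double_well divr_ge0 ?sqr_ge0. Qed.

Lemma normr_calib (r p : R) : `|calib r p| <= `|r * p|.
Proof.
have D1 := calib_den_ge1 r p; have D0 := lt_le_trans ltr01 D1.
rewrite /calib -mulrA normrM ler_piMr// normrM normfV (gtr0_norm D0).
rewrite ler_pdivrMr// mul1r.
move: (sqr_ge0 r) (sqr_ge0 p); rewrite ler_norml => ? ?.
by apply/andP; split; lra.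
Qed.

End Calibration.

(** * The lower bound *)

Section LowerBound.
Context {R : realType}.
Local Notation mu := (@lebesgue_measure R).
Implicit Types (F f : R -> R) (s t x y c e d : R).

(** Continuous induction: the supremum of the points up to which the estimate
    holds is y.  The radius d may depend on c, so that continuity at c is
    enough to establish the local estimate. *)
Lemma le_of_local_growth F x y : x <= y ->
  (forall c e, x <= c <= y -> 0 < e -> exists2 d, 0 < d &
     forall s t, x <= s -> s <= c <= t -> t <= y -> s < t -> c - d < s -> t < c + d ->
     - e * (t - s) <= F t - F s) ->
  F x <= F y.
Proof.
move=> xy loc.
suff H e : 0 < e -> - e * (y - x) <= F y - F x.
  apply/ler_addgt0Pl => e e0.
  have yx : 0 < y - x + 1 by lra.
  have := H (e / (y - x + 1)) (divr_gt0 e0 yx).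
  have : e / (y - x + 1) * (y - x) <= e.
    by rewrite -mulrA ler_piMr ?(ltW e0)// mulrC ler_pdivrMr//; lra.
  lra.
move=> e0.
pose S := [set t | x <= t <= y /\ - e * (t - x) <= F t - F x].
have Sx : S x by split; [rewrite lexx|rewrite !subrr mulr0].
have Sub : has_ubound S by exists y => t [/andP[]].
have Ssup : has_sup S by split; [exists x|].
set c := sup S.
have xc : x <= c by exact: ub_le_sup.
have cy : c <= y by apply: ge_sup; [exists x|move=> t [/andP[]]].
have [d d0 Hd] := loc c e (introT andP (conj xc cy)) e0.
have Sc : S c.
  have [t [/andP[xt ty] Ht] ct] := sup_adherent d0 Ssup.
  have tc : t <= c by apply: ub_le_sup => //; split=> //; rewrite xt.
  have [->|/eqP tnc] := eqVneq c t; first by split => //; rewrite xt.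
  split; first by rewrite xc.
  have := Hd t c xt; rewrite tc lexx => /(_ isT cy).
  have tltc : t < c by rewrite lt_neqAle tc andbT; apply/eqP => E; exact: tnc.
  move=> /(_ tltc ct ltac:(lra)); lra.
have [/eqP <-|ncy] := boolP (c == y); first by case: Sc.
have cly : c < y by rewrite lt_neqAle ncy.
pose t := Num.min (c + d / 2) y.
have ct : c < t by rewrite lt_min cly andbT; lra.
have ty : t <= y by rewrite ge_min lexx orbT.
have td : t < c + d by apply: le_lt_trans (_ : c + d / 2 < _); [rewrite ge_min lexx|lra].
have : S t.
  split; first by rewrite ty andbT; lra.
  have := Hd c t xc; rewrite lexx (ltW ct) => /(_ isT ty ct ltac:(lra) td).
  by case: Sc => _; lra.
by move=> /(ub_le_sup Sub); rewrite leNgt ct.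
Qed.

Section Energy.
Variables (a b : R) (u u1 u2 : R -> R).
Hypothesis cu : {within `[a, b], continuous u}.
Hypothesis cu1 : {within `[a, b], continuous u1}.
Hypothesis du : forall x, x \in `]a, b[ -> is_derive x 1 u (u1 x).
Hypothesis su2 : square_integrable a b u2.
Hypothesis wd : weak_derivative a b u1 u2.

(* The claim is that the integral of energy is nonnegative. *)
Let energy (t : R) : R := double_well (u t) + u2 t ^+ 2 - u1 t ^+ 2 / 8.
Let corr (t : R) : R := calib (u t) (u1 t).

Lemma within_continuous_double_well : {within `[a, b], continuous (double_well \o u)}.
Proof.
move=> t; apply: (@continuous_comp (subspace `[a, b]) _ _ u double_well); first exact: cu.
apply: differentiable_continuous; apply/derivable1_diffP.
by rewrite /double_well.
Qed.

Lemma integrable_double_well : mu.-integrable `]a, b[ (EFin \o (double_well \o u)).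
Proof.
apply: (within_continuous_integrable within_continuous_double_well).
exact: subset_itv_oo_cc.
Qed.

Lemma within_continuous_sqr_deriv : {within `[a, b], continuous (fun t => u1 t ^+ 2)}.
Proof.
move=> t; apply: (@continuous_comp (subspace `[a, b]) _ _ u1 (fun q : R => q ^+ 2)); first exact: cu1.
exact: exprn_continuous.
Qed.

Lemma integrable_sqr_deriv : mu.-integrable `]a, b[ (EFin \o (fun t => u1 t ^+ 2)).
Proof.
apply: (within_continuous_integrable within_continuous_sqr_deriv).
exact: subset_itv_oo_cc.
Qed.

Lemma integrable_gain :
  mu.-integrable `]a, b[ (EFin \o (fun t => double_well (u t) + u2 t ^+ 2)).
Proof. by apply: integrable_add => //; [exact: integrable_double_well|case: su2]. Qed.

Lemma integrable_energy : mu.-integrable `]a, b[ (EFin \o energy).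
Proof.
have h := integrable_scale (- 8^-1) (measurable_itv _) integrable_sqr_deriv.
apply: (eq_integrable _ _ _ _ (integrable_add (measurable_itv _) integrable_gain h)) => //.
by move=> t _; rewrite /= /energy mulNr mulrC.
Qed.

(** On a short interval u2 is replaced by its mean p: the tangent line
    2 p u2 - p^2 bounds u2^2 from below and has integral (t - s) p^2.  The
    calibration inequality at a point of the segment from (u, u1)(s) to
    (u, u1)(t), with a = p, then bounds the increment of corr. *)
Lemma energy_local c e : a < c < b -> 0 < e -> exists2 d, 0 < d &
  forall s t, a < s -> t < b -> s < t -> c - d < s -> t < c + d ->
  - e * (t - s) <= \int[mu]_(r in `]s, t]) energy r + (corr t - corr s).
Proof.
move=> /andP[ac cb] e0.
have ab := lt_trans ac cb.
have e3 : 0 < e / 3 by lra.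
have cab : c \in `]a, b[ by rewrite in_itv/= ac.
have cuc : {for c, continuous u}.
  by move/(continuous_within_itvP _ ab): cu => [+ _ _]; exact.
have cu1c : {for c, continuous u1}.
  by move/(continuous_within_itvP _ ab): cu1 => [+ _ _]; exact.
have cWc : {for c, continuous (double_well \o u)}.
  by move/(continuous_within_itvP _ ab): within_continuous_double_well => [+ _ _]; exact.
have cSc : {for c, continuous (fun t => u1 t ^+ 2)}.
  by move/(continuous_within_itvP _ ab): within_continuous_sqr_deriv => [+ _ _]; exact.
have [k k0 Hk] := calib_near (u c) (u1 c) e3.
have [d /= d0 Hd] : \forall r \near c, [/\ `|u c - u r| <= k, `|u1 c - u1 r| <= k,
    `|double_well (u c) - double_well (u r)| <= e / 3 &
    `|u1 c ^+ 2 - u1 r ^+ 2| <= e / 3].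
  near=> r; split; near: r.
  - by move/cvgrPdist_le: cuc; apply.
  - by move/cvgrPdist_le: cu1c; apply.
  - by move/cvgrPdist_le: cWc; apply.
  - by move/cvgrPdist_le: cSc; apply.
exists d => // s t as_ tb st cs tc.
have nearc r : s <= r <= t -> [/\ `|u r - u c| <= k, `|u1 r - u1 c| <= k,
    double_well (u c) - e / 3 <= double_well (u r) &
    u1 r ^+ 2 <= u1 c ^+ 2 + e / 3].
  move=> /andP[sr rt].
  have [|h1 h2 h3 h4] := Hd r; first by rewrite /ball_/= ltr_distl; apply/andP; split; lra.
  split; [by rewrite distrC|by rewrite distrC| |].
    by move: h3; rewrite ler_distl => /andP[]; lra.
  by move: h4; rewrite ler_distl => /andP[]; lra.
have hts : 0 < t - s by rewrite subr_gt0.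
have sub : `]s, t] `<=` `]a, b[ by apply: subset_itv; rewrite bnd_simp// ltW.
have sub' : `[s, t] `<=` `[a, b] by apply: subset_itv; rewrite bnd_simp ltW.
have iu2 := square_integrable_integrable su2.
have ftc := weak_derivative_ftc as_ st tb cu1 iu2 wd.
pose p := (u1 t - u1 s) / (t - s).
have pE : u1 t - u1 s = p * (t - s) by rewrite /p divfK// gt_eqF.
have du_st r : r \in `]s, t[%R -> is_derive r 1 u (u1 r).
  rewrite in_itv/= => /andP[sr rt]; apply: du.
  by rewrite in_itv/= (lt_trans as_ sr) (lt_trans rt tb).
have cu_st : {within `[s, t], continuous u} by exact: continuous_subspaceW cu.
have [xi xist uE] := MVT st du_st cu_st.
have [th th01 cE] := calib_increment (u s) (u1 s) (u t) (u1 t).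
have convex_near (g : R -> R) q : `|g s - q| <= k -> `|g t - q| <= k ->
    `|g s + th * (g t - g s) - q| <= k.
  have /andP[th0 th1] := th01.
  by rewrite !ler_distl => /andP[? ?] /andP[? ?]; apply/andP; split; nra.
have [s1 s2 _ _] := nearc s ltac:(apply/andP; split; lra).
have [t1 t2 _ _] := nearc t ltac:(apply/andP; split; lra).
have [_ x2 _ _] := nearc xi ltac:(by move: xist; rewrite in_itv/= => /andP[? ?]; apply/andP; split; lra).
have := Hk _ _ _ p (convex_near u _ s1 t1) (convex_near u1 _ s2 t2) x2.
rewrite /corr cE uE pE.
set gu := calib_u _ _; set gp := calib_p _ _ => key.
(* The part of the lower bound of the energy that does not involve u2. *)
pose m := double_well (u c) - e / 3 - (u1 c ^+ 2 + e / 3) / 8 - p ^+ 2.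
have low : m * (t - s) + 2 * p * (p * (t - s)) <= \int[mu]_(r in `]s, t]) energy r.
  rewrite -pE ftc.
  have iu2st := integrable_sub sub iu2.
  have mE : m * (t - s) = \int[mu]_(r in `]s, t]) (fun _ : R => m) r.
    by rewrite (Rintegral_cst_itv _ st).
  have mi : mu.-integrable `]s, t] (EFin \o (fun _ : R => m)).
    by apply: (@integrable_cst_itv _ _ s t); exact: subset_itv_oc_cc.
  rewrite mE -RintegralZl// -RintegralD//; last first.
    exact: (integrable_scale (2 * p) (measurable_itv _) iu2st).
  apply: le_Rintegral => //.
  - apply: integrable_add => //.
    exact: (integrable_scale (2 * p) (measurable_itv _) iu2st).
  - exact: (integrable_sub sub integrable_energy).
  move=> r /=; rewrite in_itv/= => /andP[sr rt].
  have [_ _ h3 h4] := nearc r ltac:(apply/andP; split; lra).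
  by rewrite /energy /m; have := sqr_ge0 (u2 r - p); lra.
have key' : - e <= m + 2 * p * p + (gu * u1 xi + gp * p) by rewrite /m; lra.
move: (ler_wpM2r (ltW hts) key'); lra.
Unshelve. all: by end_near. Qed.

Lemma energy_interior x y : a < x -> x <= y -> y < b ->
  0 <= \int[mu]_(r in `]x, y]) energy r + (corr y - corr x).
Proof.
move=> ax xy yb.
pose F t := \int[mu]_(r in `]a, t]) energy r + corr t.
have inc s t : a < s -> s <= t -> t < b ->
    F t - F s = \int[mu]_(r in `]s, t]) energy r + (corr t - corr s).
  move=> as_ st tb.
  have ie : mu.-integrable `]a, t] (EFin \o energy).
    apply: integrable_sub integrable_energy; apply: subset_itvl.
    by rewrite bnd_simp.
  rewrite /F (@Rintegral_split _ (BRight a) (BRight t) s) ?bnd_simp ?(ltW as_)//.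
  by ring.
rewrite -inc// subr_ge0; apply: le_of_local_growth => // c e /andP[xc cy] e0.
have [|d d0 Hd] := @energy_local c e _ e0; first by apply/andP; split; lra.
exists d => // s t xs _ ty st cs tc.
by rewrite inc ?(ltW st)//; [apply: Hd|..]; lra.
Qed.

Lemma corr_near0 c (G : set_system R) : Filter G ->
  u t @[t --> G] --> u c -> u1 t @[t --> G] --> 0 ->
  forall d, 0 < d -> \forall t \near G, `|corr t| <= d.
Proof.
move=> FG uc u1c d d0.
have : u t * u1 t @[t --> G] --> 0 by rewrite -(mulr0 (u c)); exact: cvgM.
move/cvgr0Pnorm_le => /(_ _ d0); apply: filterS => t; apply: le_trans.
exact: normr_calib.
Qed.

(** [energy_interior] applied on ]x, y] with x and y tending to the ends: corr
    tends to 0 there, and the energy of the two remaining pieces is at least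
    minus the integral of u1^2 / 8 over them. *)
Lemma energy_ge0 : a < b -> u1 a = 0 -> u1 b = 0 ->
  0 <= \int[mu]_(t in `]a, b[) energy t.
Proof.
move=> ab ua ub.
pose g t := u1 t ^+ 2 * 8^-1.
have cg : {within `[a, b], continuous g}.
  by move=> t; apply: cvgM; [exact: within_continuous_sqr_deriv|exact: cvg_cst].
have gi : mu.-integrable `[a, b] (EFin \o g) by exact: within_continuous_integrable cg _.
have ge (i : interval R) : [set` i] `<=` `]a, b[ ->
    - (\int[mu]_(t in [set` i]) g t) <= \int[mu]_(t in [set` i]) energy t.
  move=> iab.
  have gi' : mu.-integrable [set` i] (EFin \o g).
    by apply: integrable_sub gi => t /iab; exact: subset_itv_oo_cc.
  rewrite (_ : - _ = \int[mu]_(t in [set` i]) (-1 * g t)); last first.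
    by rewrite RintegralZl// mulN1r.
  apply: le_Rintegral => //.
  - exact: (integrable_scale _ _ gi').
  - exact: (integrable_sub iab integrable_energy).
  move=> t /iab tab; rewrite /energy /g.
  by have := sqr_ge0 (u2 t); have := double_well_ge0 (u t); lra.
have [_ ca cb] := (continuous_within_itvP _ ab).1 cu.
have [_ c1a c1b] := (continuous_within_itvP _ ab).1 cu1.
apply/ler_addgt0Pl => e e0.
have e4 : 0 < e / 4 by lra.
near a^'+ => x; near b^'- => y.
have ax : a < x by [].
have yb : y < b by [].
have xm : x < (a + b) / 2 by near: x; apply: nbhs_right_lt; lra.
have my : (a + b) / 2 < y by near: y; apply: nbhs_left_gt; lra.
have corx : `|corr x| <= e / 4.
  by near: x; apply: (@corr_near0 a) => //; rewrite -ua.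
have cory : `|corr y| <= e / 4.
  by near: y; apply: (@corr_near0 b) => //; rewrite -ub.
have gx : `|\int[mu]_(t in `[a, x]) g t| <= e / 4.
  near: x; apply: cvgr0_norm_le => //.
  exact: cvg_at_right_filter (parameterized_integral_cvg_left ab gi).
have gy : `|\int[mu]_(t in `[a, b]) g t - \int[mu]_(t in `[a, y]) g t| <= e / 4.
  near: y; move/cvgrPdist_le: (parameterized_integral_cvg_at_left ab gi); exact.
have gab : mu.-integrable `]a, b] (EFin \o g).
  by apply: (integrable_sub _ gi); exact: subset_itv_oc_cc.
have sub_ax : `]a, x] `<=` `]a, b[ by apply: subset_itvl; rewrite bnd_simp; lra.
have sub_yb : `]y, b[ `<=` `]a, b[ by apply: subset_itvr; rewrite bnd_simp; lra.
have sub_xb : `]x, b[ `<=` `]a, b[ by apply: subset_itvr; rewrite bnd_simp; lra.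
have gyb : \int[mu]_(t in `]y, b[) g t <= e / 4.
  rewrite Rintegral_itv_bndo_bndc; last first.
    by apply: (integrable_sub _ gi); apply: subset_trans sub_yb _; exact: subset_itv_oo_cc.
  rewrite -(@Rintegral_itvB _ _ (BLeft a)) ?bnd_simp; [|exact: gi|lra|lra].
  exact: le_trans (ler_norm _) gy.
have gax : \int[mu]_(t in `]a, x]) g t <= e / 4.
  rewrite Rintegral_itv_obnd_cbnd; first exact: le_trans (ler_norm _) gx.
  by apply: (integrable_sub _ gi); apply: subset_trans sub_ax _; exact: subset_itv_oo_cc.
have xy : x <= y by exact: ltW (lt_trans xm my).
have xb : x < b by exact: le_lt_trans xy yb.
rewrite (Rintegral_split (x := x) integrable_energy) ?bnd_simp ?(ltW ax)//.
rewrite (Rintegral_split (x := y) (integrable_sub sub_xb integrable_energy)) ?bnd_simp//.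
have := energy_interior ax xy yb.
have := ge _ sub_ax; have := ge _ sub_yb.
move: corx cory gax gyb; rewrite !ler_norml.
move: (\int[mu]_(t in `]a, x]) g t) (\int[mu]_(t in `]y, b[) g t).
move: (\int[mu]_(t in `]a, x]) _) (\int[mu]_(t in `]y, b[) _) (\int[mu]_(t in `]x, y]) _).
move: (corr x) (corr y) => X Y A B C P Q.
move=> /andP[x1 x2] /andP[y1 y2] P1 Q1 yb1 ax1 xy1.
by clear -x1 x2 y1 y2 P1 Q1 yb1 ax1 xy1; lra.
Unshelve. all: by end_near. Qed.

Lemma energy_lower_bound : a < b -> u1 a = 0 -> u1 b = 0 ->
  8^-1 * \int[mu]_(t in `]a, b[) (u1 t ^+ 2) <=
  \int[mu]_(t in `]a, b[) (double_well (u t) + u2 t ^+ 2).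
Proof.
move=> ab ua ub; have := energy_ge0 ab ua ub.
rewrite -subr_ge0 -RintegralZl//; last exact: integrable_sqr_deriv.
rewrite -RintegralB//; last 2 first.
- exact: integrable_gain.
- exact: (integrable_scale _ _ integrable_sqr_deriv).
move=> /le_trans; apply; rewrite le_eqVlt; apply/orP; left; apply/eqP.
by apply: eq_Rintegral => t _; rewrite /energy mulrC.
Qed.
End Energy.

Lemma rayleigh_ge_eighth (L : R) (u u1 u2 : R -> R) : 0 < L ->
  admissible L u u1 u2 -> ((8^-1)%:E <= rayleigh (- L) L u u1 u2)%E.
Proof.
move=> L0 [[[cu cu1 du] [_ _ su2] _ wd] uNL uL _].
rewrite /rayleigh; case: ifPn => [d0|_]; last exact: leey.
rewrite lee_fin ler_pdivlMr//.
apply: (energy_lower_bound cu cu1 du su2 wd) => //; lra.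
Qed.

Lemma k1_ge_eighth : ((8^-1)%:E <= k1 R)%E.
Proof.
apply: le_ereal_inf_tmp => _ [L /= L0 <-].
by apply: le_ereal_inf_tmp => _ [u [u1 [u2 [adm ->]]]]; exact: rayleigh_ge_eighth.
Qed.

End LowerBound.

(** * The upper bound *)

Section UpperBound.
Context {R : realType}.
Local Notation mu := (@lebesgue_measure R).
Implicit Types (f g phi : R -> R) (a b t x : R).

(** The product of f and a test function vanishes at both ends. *)
Lemma weak_derivative_C1 a b f g : a < b -> (forall t, is_derive t 1 f (g t)) ->
  continuous g -> weak_derivative a b f g.
Proof.
move=> ab df cg phi [sphi [c [d [ac db phi0]]]].
have dphi t : is_derive t 1 phi (derive1 phi t).
  by rewrite derive1E; exact: (derivableP (sphi 0%N t)).
have cf := is_derive_continuous df.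
have cphi := is_derive_continuous dphi.
have cphi' : continuous (derive1 phi).
  by move=> t; apply: differentiable_continuous; exact/derivable1_diffP/(sphi 1%N).
have ib h : continuous h -> mu.-integrable `]a, b[ (EFin \o h).
  move=> ch; apply: (@within_continuous_integrable _ _ a b); last exact: subset_itv_oo_cc.
  exact: continuous_subspaceT.
have c1 : continuous (fun t => f t * derive1 phi t).
  by move=> t; apply: cvgM; [exact: cf|exact: cphi'].
have c2 : continuous (fun t => g t * phi t).
  by move=> t; apply: cvgM; [exact: cg|exact: cphi].
apply/eqP; rewrite -addr_eq0 -RintegralD//; [|exact: ib|exact: ib].
have dF t : is_derive t 1 (f * phi) (f t * derive1 phi t + g t * phi t).
  by apply: (is_derive_eq (is_deriveM (df t) (dphi t))); rewrite /GRing.scale /=; ring.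
rewrite (Rintegral_oo_derive ab dF); last by move=> t; apply: cvgD; [exact: c1|exact: c2].
by rewrite !fctE !phi0 ?mulr0 ?subrr// in_itv/= negb_and -!ltNge ?ac ?db ?orbT.
Qed.

Lemma continuous_square_integrable a b f : continuous f -> square_integrable a b f.
Proof.
move=> cf; split.
  by apply: measurable_funTS; exact: continuous_measurable_fun.
apply: (@within_continuous_integrable _ (fun t => f t ^+ 2) a b); last exact: subset_itv_oo_cc.
apply: continuous_subspaceT => t.
by apply: (@continuous_comp _ _ _ f (fun q : R => q ^+ 2)); [exact: cf|exact: exprn_continuous].
Qed.

Lemma sobolev22_C2 a b f g h : a < b -> (forall t, is_derive t 1 f (g t)) ->
  (forall t, is_derive t 1 g (h t)) -> continuous h -> sobolev22 a b f g h.
Proof.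
move=> ab df dg ch.
have cf := is_derive_continuous df; have cg := is_derive_continuous dg.
split; [split|split| |].
- exact: continuous_subspaceT.
- exact: continuous_subspaceT.
- by move=> t _; exact: df.
- exact: continuous_square_integrable.
- exact: continuous_square_integrable.
- exact: continuous_square_integrable.
- exact: weak_derivative_C1.
- exact: weak_derivative_C1.
Qed.

(** Rational approximations of the optimal frequency 0.579 and amplitude 1.278
    among the functions amp * sin (freq * t). *)
Definition freq : R := 3 / 5.
Definition amp : R := 5 / 4.
Definition half_len : R := pi / 2 / freq.
Definition trial t : R := amp * sin (freq * t).
Definition trial1 t : R := amp * freq * cos (freq * t).
Definition trial2 t : R := - (amp * freq ^+ 2) * sin (freq * t).

Lemma is_derive_sin_freq t : is_derive t 1 (fun t => sin (freq * t)) (freq * cos (freq * t)).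
Proof.
have dl : is_derive t 1 (fun t : R => freq * t) freq.
  by apply: is_derive_eq; rewrite /GRing.scale /=; ring.
by apply: (is_derive_eq (is_derive1_comp (is_derive_sin _) dl)); rewrite mulrC.
Qed.

Lemma is_derive_cos_freq t : is_derive t 1 (fun t => cos (freq * t)) (- (freq * sin (freq * t))).
Proof.
have dl : is_derive t 1 (fun t : R => freq * t) freq.
  by apply: is_derive_eq; rewrite /GRing.scale /=; ring.
by apply: (is_derive_eq (is_derive1_comp (is_derive_cos _) dl)); rewrite mulrC mulrN.
Qed.

Lemma continuous_sin_freq : continuous (fun t : R => sin (freq * t)).
Proof. exact: is_derive_continuous is_derive_sin_freq. Qed.

Lemma is_derive_trial t : is_derive t 1 trial (trial1 t).
Proof.
have h := is_deriveM (is_derive_cst amp t 1) (is_derive_sin_freq t).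
by apply: (is_derive_eq h); rewrite /trial1 /GRing.scale /= ?fctE; ring.
Qed.

Lemma is_derive_trial1 t : is_derive t 1 trial1 (trial2 t).
Proof.
have h := is_deriveM (is_derive_cst (amp * freq) t 1) (is_derive_cos_freq t).
by apply: (is_derive_eq h); rewrite /trial2 /GRing.scale /= ?fctE; ring.
Qed.

Lemma continuous_trial2 : continuous trial2.
Proof. by move=> t; apply: cvgM; [exact: cvg_cst|exact: continuous_sin_freq]. Qed.

Lemma freq_gt0 : 0 < freq.
Proof. by rewrite /freq; lra. Qed.

Lemma freq_half_len : freq * half_len = pi / 2.
Proof. by rewrite /half_len mulrC divfK// gt_eqF// freq_gt0. Qed.

Lemma half_len_gt0 : 0 < half_len.
Proof. by rewrite /half_len !divr_gt0 ?pi_gt0 ?freq_gt0. Qed.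

Lemma trial1_half_len : trial1 half_len = 0.
Proof. by rewrite /trial1 freq_half_len cos_pihalf mulr0. Qed.

Lemma trial1_opp_half_len : trial1 (- half_len) = 0.
Proof. by rewrite /trial1 mulrN cosN freq_half_len cos_pihalf mulr0. Qed.

Lemma admissible_trial : admissible half_len trial trial1 trial2.
Proof.
have L := half_len_gt0.
split; [|exact: trial1_opp_half_len|exact: trial1_half_len|].
  apply: sobolev22_C2; [lra|exact: is_derive_trial|exact: is_derive_trial1|exact: continuous_trial2].
exists 0; first by rewrite in_itv/=; apply/andP; split; lra.
by rewrite /trial1 mulr0 cos0 mulr1 /amp /freq; lra.
Qed.

(** The trigonometric part vanishes where the cosine does, so that only the
    linear part contributes to an integral over ]- half_len, half_len[. *)
Definition trig_prim (k al be : R) t : R :=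
  k * t + (al * sin (freq * t) + be * sin (freq * t) ^+ 3) * cos (freq * t).

Lemma is_derive_trig_prim k al be t : is_derive t 1 (trig_prim k al be)
  (k + freq * al + (freq * (3 * be - 2 * al)) * sin (freq * t) ^+ 2
   - 4 * freq * be * sin (freq * t) ^+ 4).
Proof.
have ds := is_derive_sin_freq t; have dc := is_derive_cos_freq t.
have dl : is_derive t 1 (fun t : R => k * t) k.
  by apply: is_derive_eq; rewrite /GRing.scale /=; ring.
have ds3 := @is_deriveX _ _ (fun t : R => sin (freq * t)) 3 t 1 _ ds.
have h := is_deriveD dl (is_deriveM (is_deriveD
  (is_deriveM (is_derive_cst al t 1) ds) (is_deriveM (is_derive_cst be t 1) ds3)) dc).
apply: (is_derive_eq h); rewrite /GRing.scale /= !fctE.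
have := cos2Dsin2 (freq * t); move: (cos _) (sin _) => c s cs.
have c2 : c ^+ 2 = 1 - s ^+ 2 by rewrite -cs; ring.
transitivity (k + freq * (al + 3 * be * s ^+ 2) * c ^+ 2 - freq * (al * s + be * s ^+ 3) * s).
  by ring.
by rewrite c2; ring.
Qed.

Lemma Rintegral_trig k al be f :
  (forall t, f t = k + freq * al + (freq * (3 * be - 2 * al)) * sin (freq * t) ^+ 2
   - 4 * freq * be * sin (freq * t) ^+ 4) ->
  \int[mu]_(t in `](- half_len), half_len[) f t = 2 * k * half_len.
Proof.
move=> fE; have -> : f = (fun t => k + freq * al + (freq * (3 * be - 2 * al)) * sin (freq * t) ^+ 2
   - 4 * freq * be * sin (freq * t) ^+ 4) by apply/funext.
rewrite (Rintegral_oo_derive _ (is_derive_trig_prim k al be)).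
- by rewrite /trig_prim !mulrN cosN freq_half_len cos_pihalf !mulr0; ring.
- by have := half_len_gt0; lra.
- have cX n : continuous (fun t : R => sin (freq * t) ^+ n).
    move=> t; apply: (@continuous_comp _ _ _ (fun t : R => sin (freq * t)) (fun q : R => q ^+ n)).
      exact: continuous_sin_freq.
    exact: exprn_continuous.
  move=> t; apply: cvgB; last by apply: cvgM; [exact: cvg_cst|exact: cX].
  apply: cvgD; first exact: cvg_cst.
  by apply: cvgM; [exact: cvg_cst|exact: cX].
Qed.

Lemma Rintegral_trial1_sqr :
  \int[mu]_(t in `](- half_len), half_len[) (trial1 t ^+ 2) = amp ^+ 2 * freq ^+ 2 * half_len.
Proof.
rewrite (@Rintegral_trig (amp ^+ 2 * freq ^+ 2 / 2) (amp ^+ 2 * freq / 2) 0).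
  by field.
by move=> t; rewrite /trial1 exprMn cos2sin2; field.
Qed.

Lemma Rintegral_trial_energy :
  \int[mu]_(t in `](- half_len), half_len[) (double_well (trial t) + trial2 t ^+ 2) =
  2 * (1 / 4 - amp ^+ 2 / 4 + 3 * amp ^+ 4 / 32 + amp ^+ 2 * freq ^+ 4 / 2) * half_len.
Proof.
have w0 : freq != 0 by rewrite gt_eqF// freq_gt0.
pose be := - amp ^+ 4 / 16 / freq.
pose al := (amp ^+ 2 / 2 - amp ^+ 2 * freq ^+ 4 + 3 * freq * be) / 2 / freq.
apply: (@Rintegral_trig _ al be) => t.
by rewrite /double_well /trial /trial2 /al /be; field.
Qed.

Lemma k1_le : (k1 R <= (6846 / 10000)%:E)%E.
Proof.
have L := half_len_gt0.
have num := Rintegral_trial_energy; have den := Rintegral_trial1_sqr.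
have den0 : 0 < amp ^+ 2 * freq ^+ 2 * half_len by apply: mulr_gt0 => //; rewrite /amp /freq; lra.
apply: (@le_trans _ _ (rayleigh (- half_len) half_len trial trial1 trial2)).
  apply: (@le_trans _ _ (k1_on half_len)).
    by apply: ereal_inf_lbound; exists half_len.
  apply: ereal_inf_lbound; exists trial, trial1, trial2; split => //; exact: admissible_trial.
rewrite /rayleigh den den0 num lee_fin ler_pdivrMr//.
by rewrite [leRHS]mulrA ler_pM2r// /amp /freq; lra.
Qed.

End UpperBound.

Theorem mainTheorem6 (R : realType) :
  ((1 / 8 : R)%R%:E <= k1 R)%E /\ (k1 R <= (6846 / 10000 : R)%R%:E)%E.
Proof.
split; last exact: k1_le.
by rewrite div1r; exact: k1_ge_eighth.
Qed.
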